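(* For all $\alpha,\beta\in\mathcal{F}_{\sim,\neg}$ the following are equivalent: (1) $\alpha\vdash_{\mathcal{L}_{DBS}}\beta$; (2) $\alpha\vdash\beta$ is valid in the class of all double Stone algebras; (3) $\alpha\vdash\beta$ is valid in the class of all double Stone algebras $B^{[3]}$, $B$ ranging over all Boolean algebras; (4) $\alpha\vdash\beta$ is valid in the class of all double Stone algebras $(\mathcal{P}(U))^{[3]}$, $U$ ranging over all sets.
   Context: A double Stone algebra is an algebra $(A,\vee,\wedge,\sim,\neg,0,1)$ such that $(A,\vee,\wedge,0,1)$ is a bounded distributive lattice; for every $a\in A$, $\sim a=\max\{c\in A:a\wedge c=0\}$ and $\neg a=\min\{c\in A:a\vee c=1\}$ exist; and $\sim a\vee\sim\sim a=1$, $\neg a\wedge\neg\neg a=0$ for all $a$. For a Boolean algebra $B$ with complement $^{c}$, $B^{[3]}:=\{(b_1,b_2,b_3)\in B^3:b_1\le b_2\le b_3\}$ with componentwise $\vee,\wedge$, bottom $(0,0,0)$, top $(1,1,1)$, $\sim(b_1,b_2,b_3):=(b_3^{c},b_3^{c},b_3^{c})$ and $\neg(b_1,b_2,b_3):=(b_1^{c},b_1^{c},b_1^{c})$; this is a double Stone algebra. $(\mathcal{P}(U))^{[3]}$ is the case $B=\mathcal{P}(U)$. Formulas $\mathcal{F}_{\sim,\neg}$: built from propositional variables $p,q,r,\ldots$ and constants $\top,\bot$ with binary connectives $\vee,\wedge$ and unary connectives $\sim,\neg$. $\vdash_{\mathcal{L}_{DBS}}$ is the least relation on $\mathcal{F}_{\sim,\neg}$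 satisfying the following postulates and rules (premises / conclusion), for all formulas. BDLL: $\alpha\vdash\alpha$; $\alpha\vdash\beta,\ \beta\vdash\gamma\,/\,\alpha\vdash\gamma$; $\alpha\wedge\beta\vdash\alpha$, $\alpha\wedge\beta\vdash\beta$; $\alpha\vdash\beta,\ \alpha\vdash\gamma\,/\,\alpha\vdash\beta\wedge\gamma$; $\alpha\vdash\alpha\vee\beta$, $\beta\vdash\alpha\vee\beta$; $\alpha\vdash\gamma,\ \beta\vdash\gamma\,/\,\alpha\vee\beta\vdash\gamma$; $\alpha\wedge(\beta\vee\gamma)\vdash(\alpha\wedge\beta)\vee(\alpha\wedge\gamma)$; $\alpha\vdash\top$; $\bot\vdash\alpha$. Additional: $\sim\alpha\wedge\sim\beta\vdash\sim(\alpha\vee\beta)$, $\neg(\alpha\wedge\beta)\vdash\neg\alpha\vee\neg\beta$; $\top\vdash\sim\bot$, $\neg\top\vdash\bot$; $\alpha\vdash\beta\,/\,\sim\beta\vdash\sim\alpha$, $\alpha\vdash\beta\,/\,\neg\beta\vdash\neg\alpha$; $\sim\alpha\wedge\neg\beta\vdash\neg(\alpha\vee\beta)$, $\sim(\alpha\wedge\beta)\vdash\sim\alpha\vee\neg\beta$; $\alpha\wedge\sim\alpha\vdash\bot$, $\top\vdash\alpha\vee\neg\alpha$; $\alpha\wedge\beta\vdash\gamma\,/\,\alpha\wedge\sim\gamma\vdash\sim\beta$, $\gamma\vdash\alpha\vee\beta\,/\,\neg\beta\vdash\alpha\vee\neg\gamma$; $\top\vdash\sim\alpha\vee\sim\sim\alpha$,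 $\neg\alpha\wedge\neg\neg\alpha\vdash\bot$. A valuation in an algebra $A$ is a map $v$ from formulas to $A$ preserving $\vee,\wedge,\sim,\neg$ with $v(\bot)=0$, $v(\top)=1$. The consequent $\alpha\vdash\beta$ is valid in $A$ if $v(\alpha)\le v(\beta)$ for all valuations $v$ in $A$, and valid in a class of algebras if it is valid in each member. *)

(* Defs.v *)
From HB Require Import structures.
From mathcomp Require Import all_boot all_order.
From mathcomp Require Import boolp classical_sets.

Set Implicit Arguments.
Unset Strict Implicit.
Unset Printing Implicit Defensive.

Import Order.Theory.
Local Open Scope order_scope.

(* The lattices of the order library carry a boolean order and a choice       *)
(* operator; with the classical axioms of boolp every lattice has both, so    *)
(* quantifying over these structures loses no algebra.                        *)
HB.mixin Record TBDistrLattice_isDoubleStone d T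
    of Order.TBDistrLattice d T := {
  pcompl : T -> T;
  dpcompl : T -> T;
  (* pcompl a = max {c | a `&` c = \bot} *)
  meetx_pcompl : forall a : T, a `&` pcompl a = \bot;
  pcompl_max : forall a c : T, a `&` c = \bot -> c <= pcompl a;
  (* dpcompl a = min {c | a `|` c = \top} *)
  joinx_dpcompl : forall a : T, a `|` dpcompl a = \top;
  dpcompl_min : forall a c : T, a `|` c = \top -> dpcompl a <= c;
  pcompl_stone : forall a : T, pcompl a `|` pcompl (pcompl a) = \top;
  dpcompl_stone : forall a : T, dpcompl a `&` dpcompl (dpcompl a) = \bot
}.

#[short(type="doubleStoneType")]
HB.structure Definition DoubleStone d :=
  { T of Order.TBDistrLattice d T & TBDistrLattice_isDoubleStone d T }.

Section Three.
Context (d : Order.disp_t) (B : ctbDistrLatticeType d).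

Definition chain3 : {pred B *p B *p B} :=
  fun b => (b.1.1 <= b.1.2) && (b.1.2 <= b.2).

Record three := Three { three_val : B *p B *p B; _ : chain3 three_val }.

HB.instance Definition _ := [isSub for three_val].
HB.instance Definition _ := [Choice of three by <:].

Fact chain3_meet : {in chain3 &, forall x y, x `&` y \in chain3}.
Proof.
move=> [[a1 a2] a3] [[b1 b2] b3] /andP[/= a12 a23] /andP[/= b12 b23].
by apply/andP; split; apply: leI2.
Qed.

Fact chain3_join : {in chain3 &, forall x y, x `|` y \in chain3}.
Proof.
move=> [[a1 a2] a3] [[b1 b2] b3] /andP[/= a12 a23] /andP[/= b12 b23].
by apply/andP; split; apply: leU2.
Qed.

Fact chain3_bot : \bot \in chain3.
Proof. by apply/andP; split; apply: lexx. Qed.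

Fact chain3_top : \top \in chain3.
Proof. by apply/andP; split; apply: lexx. Qed.

HB.instance Definition _ := Order.isTBLatticeClosed.Build _ _ chain3
  chain3_meet chain3_join chain3_bot chain3_top.

HB.instance Definition _ := [SubChoice_isTBSubLattice of three by <: with d].

Fact three_leE (x y : three) :
  (x <= y) = [&& (val x).1.1 <= (val y).1.1, (val x).1.2 <= (val y).1.2
                & (val x).2 <= (val y).2].
Proof. by rewrite andbA. Qed.

Fact three_meetE (x y : three) :
  val (x `&` y) = ((val x).1.1 `&` (val y).1.1, (val x).1.2 `&` (val y).1.2,
                   (val x).2 `&` (val y).2).
Proof. by []. Qed.

Fact three_joinE (x y : three) :
  val (x `|` y) = ((val x).1.1 `|` (val y).1.1, (val x).1.2 `|` (val y).1.2,
                   (val x).2 `|` (val y).2).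
Proof. by []. Qed.

Fact three_meetUl : @left_distributive three three Order.meet Order.join.
Proof.
move=> x y z; apply: val_inj.
by rewrite !(three_meetE, three_joinE) /= !meetUl.
Qed.

HB.instance Definition _ :=
  Order.Lattice_Meet_isDistrLattice.Build d three three_meetUl.

Fact three_botE : val (\bot : three) = (\bot, \bot, \bot).
Proof. by []. Qed.

Fact three_topE : val (\top : three) = (\top, \top, \top).
Proof. by []. Qed.

Fact chain3_diag (b : B) : chain3 (b, b, b).
Proof. by rewrite /chain3 /= lexx. Qed.

Definition three_pcompl (b : three) : three :=
  Three (chain3_diag (~` (val b).2)).

Definition three_dpcompl (b : three) : three :=
  Three (chain3_diag (~` (val b).1.1)).

Fact three_le12 (b : three) : (val b).1.1 <= (val b).1.2.
Proof. by case: b => b /= /andP[]. Qed.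

Fact three_le23 (b : three) : (val b).1.2 <= (val b).2.
Proof. by case: b => b /= /andP[]. Qed.

Fact three_meetx_pcompl (b : three) : b `&` three_pcompl b = \bot.
Proof.
have e (c : B) : c <= (val b).2 -> c `&` ~` (val b).2 = \bot.
  by move=> lecb; apply/eqP; rewrite disj_leC complK.
have le23 := three_le23 b; have le13 := le_trans (three_le12 b) le23.
by apply: val_inj; rewrite three_meetE three_botE !e.
Qed.

Fact three_pcompl_max (a c : three) : a `&` c = \bot -> c <= three_pcompl a.
Proof.
move=> /(congr1 val); rewrite three_meetE three_botE => -[_ _ /eqP].
rewrite meetC disj_leC three_leE /= => h3.
have h2 := le_trans (three_le23 c) h3.
by rewrite h3 h2 (le_trans (three_le12 c) h2).
Qed.

Fact three_joinx_dpcompl (b : three) : b `|` three_dpcompl b = \top.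
Proof.
have e (c : B) : (val b).1.1 <= c -> c `|` ~` (val b).1.1 = \top.
  move=> lebc; apply/eqP; rewrite -le1x -(joinxC (val b).1.1) leUx leUr andbT.
  exact: le_trans lebc (leUl _ _).
have le12 := three_le12 b; have le13 := le_trans le12 (three_le23 b).
by apply: val_inj; rewrite three_joinE three_topE !e.
Qed.

Fact three_dpcompl_min (a c : three) : a `|` c = \top -> three_dpcompl a <= c.
Proof.
move=> /(congr1 val); rewrite three_joinE three_topE => -[e1 _ _].
have h1 : ~` (val a).1.1 <= (val c).1.1.
  by rewrite -[(val c).1.1]complK -disj_leC -complU e1 compl1.
have h2 := le_trans h1 (three_le12 c).
by rewrite three_leE /= h1 h2 (le_trans h2 (three_le23 c)).
Qed.

Fact three_pcompl_stone (b : three) :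
  three_pcompl b `|` three_pcompl (three_pcompl b) = \top.
Proof. by apply: val_inj; rewrite three_joinE three_topE /= joinxC. Qed.

Fact three_dpcompl_stone (b : three) :
  three_dpcompl b `&` three_dpcompl (three_dpcompl b) = \bot.
Proof. by apply: val_inj; rewrite three_meetE three_botE /= meetxC. Qed.

HB.instance Definition _ := TBDistrLattice_isDoubleStone.Build d three
  three_meetx_pcompl three_pcompl_max three_joinx_dpcompl three_dpcompl_min
  three_pcompl_stone three_dpcompl_stone.

End Three.

Notation "B ^[3]" := (three B) (at level 2, format "B ^[3]") : type_scope.

Inductive formula : Set :=
| Var of nat
| Top
| Bot
| Or of formula & formula
| And of formula & formula
| Sim of formula
| Neg of formula.

Declare Scope formula_scope.
Delimit Scope formula_scope with F.
Bind Scope formula_scope with formula.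
Local Open Scope formula_scope.

Notation "a \v b" := (Or a b) (at level 50, left associativity) : formula_scope.
Notation "a \& b" := (And a b) (at level 40, left associativity) : formula_scope.
Notation "\~ a" := (Sim a) (at level 35, right associativity) : formula_scope.
Notation "\neg a" := (Neg a) (at level 35, right associativity) : formula_scope.

Reserved Notation "a |-DBS b" (at level 70, no associativity).

Inductive DBS : formula -> formula -> Prop :=
| DBS_refl a : a |-DBS a
| DBS_trans a b c : a |-DBS b -> b |-DBS c -> a |-DBS c
| DBS_andl a b : a \& b |-DBS a
| DBS_andr a b : a \& b |-DBS b
| DBS_and a b c : a |-DBS b -> a |-DBS c -> a |-DBS b \& c
| DBS_orl a b : a |-DBS a \v b
| DBS_orr a b : b |-DBS a \v b
| DBS_or a b c : a |-DBS c -> b |-DBS c -> a \v b |-DBS c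
| DBS_distr a b c : a \& (b \v c) |-DBS (a \& b) \v (a \& c)
| DBS_top a : a |-DBS Top
| DBS_bot a : Bot |-DBS a
| DBS_sim_or a b : \~ a \& \~ b |-DBS \~ (a \v b)
| DBS_neg_and a b : \neg (a \& b) |-DBS \neg a \v \neg b
| DBS_sim_bot : Top |-DBS \~ Bot
| DBS_neg_top : \neg Top |-DBS Bot
| DBS_sim_mono a b : a |-DBS b -> \~ b |-DBS \~ a
| DBS_neg_mono a b : a |-DBS b -> \neg b |-DBS \neg a
| DBS_sim_neg_or a b : \~ a \& \neg b |-DBS \neg (a \v b)
| DBS_sim_neg_and a b : \~ (a \& b) |-DBS \~ a \v \neg b
| DBS_and_sim a : a \& \~ a |-DBS Bot
| DBS_or_neg a : Top |-DBS a \v \neg a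
| DBS_sim_res a b c : a \& b |-DBS c -> a \& \~ c |-DBS \~ b
| DBS_neg_res a b c : c |-DBS a \v b -> \neg b |-DBS a \v \neg c
| DBS_sim_stone a : Top |-DBS \~ a \v \~ \~ a
| DBS_neg_stone a : \neg a \& \neg \neg a |-DBS Bot
where "a |-DBS b" := (DBS a b).

Section Validity.
Context (d : Order.disp_t) (A : doubleStoneType d).

Record is_valuation (v : formula -> A) : Prop := IsValuation {
  valuation_or : forall a b, v (a \v b) = v a `|` v b;
  valuation_and : forall a b, v (a \& b) = v a `&` v b;
  valuation_sim : forall a, v (\~ a) = pcompl (v a);
  valuation_neg : forall a, v (\neg a) = dpcompl (v a);
  valuation_bot : v Bot = \bot;
  valuation_top : v Top = \top
}.

Definition valid (a b : formula) : Prop :=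
  forall v : formula -> A, is_valuation v -> v a <= v b.

End Validity.

(* Main.v *)
(* Completeness already holds for the four-element chain P({*})^[3].  If a    *)
(* does not prove b, Zorn's lemma gives a prime theory P containing a but not *)
(* b, and c |-> (\neg c \notin P, c \in P, \~ c \notin P) is a valuation      *)
(* separating them: the three coordinates say that c belongs to the least     *)
(* prime theory below P, to P itself, and to the greatest one above P.        *)

Require Import Defs.
From mathcomp Require Import all_boot all_order.
From mathcomp Require Import boolp classical_sets.

Set Implicit Arguments.
Unset Strict Implicit.
Unset Printing Implicit Defensive.

Local Open Scope formula_scope.

Import Order.Theory.

(** The conditions are proved in a cycle. Soundness is an induction on derivations, and the two
    middle steps restrict the class of algebras, so the weight lies in deriving [a |-DBS b] from
    validity in [(set unit)^[3]] alone. The valuation attached to a prime theory is a homomorphism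
    for two reasons. Both negations satisfy both De Morgan laws; [DBS_sim_and] and [DBS_neg_or] need
    the Stone axioms. Moreover every negated formula is complemented: [DBS_sim_neg_sim] and
    [DBS_neg_sim_neg] make a negation of a negation its Boolean complement, which a prime theory
    decides by [prime_complE]. *)

(** * Soundness in every double Stone algebra *)

Section Soundness.
Local Open Scope order_scope.
Context {d : Order.disp_t} {A : doubleStoneType d}.
Implicit Types x y z : A.

(** The maximum property as an equivalence; with its dual [dpcompl_le] it turns inequalities about
    negations into lattice computations. *)
Lemma le_pcompl x y : (y <= pcompl x) = (x `&` y <= \bot).
Proof.
rewrite lex0; apply/idP/eqP => [le_yx|/pcompl_max//]; apply/le_anti.
by rewrite le0x andbT -(meetx_pcompl x) leI2.
Qed.

Lemma dpcompl_le x y : (dpcompl x <= y) = (\top <= x `|` y).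
Proof.
rewrite le1x; apply/idP/eqP => [le_xy|/dpcompl_min//]; apply/le_anti.
by rewrite lex1 -(joinx_dpcompl x) leU2.
Qed.

Lemma le_pcompl_join x y : pcompl x `&` pcompl y <= pcompl (x `|` y).
Proof.
by rewrite le_pcompl meetUl leUx meetA meetx_pcompl meet0x meetCA
  meetx_pcompl meetx0 lexx.
Qed.

Lemma dpcompl_meet_le x y : dpcompl (x `&` y) <= dpcompl x `|` dpcompl y.
Proof.
by rewrite dpcompl_le joinIl lexI joinA joinx_dpcompl join1x joinCA
  joinx_dpcompl joinx1 lexx.
Qed.

Lemma le_pcompl_anti x y : x <= y -> pcompl y <= pcompl x.
Proof. by move=> le_xy; rewrite le_pcompl -(meetx_pcompl y) leI2. Qed.

Lemma le_dpcompl_anti x y : x <= y -> dpcompl y <= dpcompl x.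
Proof. by move=> le_xy; rewrite dpcompl_le -(joinx_dpcompl x) leU2. Qed.

Lemma pcompl_dpcompl_join x y : pcompl x `&` dpcompl y <= dpcompl (x `|` y).
Proof.
set z := dpcompl (x `|` y).
(* Since [y] joined with [x] and [z] is the top, minimality bounds [dpcompl y]; meeting with
   [pcompl x] then removes [x]. *)
have le_y : dpcompl y <= x `|` z.
  by rewrite dpcompl_le joinA (joinC y) joinx_dpcompl.
apply: (le_trans (leI2 (lexx _) le_y)).
by rewrite meetUr meetC meetx_pcompl join0x leIr.
Qed.

Lemma pcompl_meet_dpcompl x y : pcompl (x `&` y) <= pcompl x `|` dpcompl y.
Proof.
set z := pcompl (x `&` y).
have le_x : y `&` z <= pcompl x by rewrite le_pcompl meetA meetx_pcompl.
apply: le_trans (leU2 le_x (lexx _)).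
by rewrite joinIl joinx_dpcompl meet1x leUl.
Qed.

Lemma pcompl_residual x y z :
  x `&` y <= z -> x `&` pcompl z <= pcompl y.
Proof.
move=> le_z; rewrite le_pcompl meetA (meetC y) -(meetx_pcompl z).
exact: leI2.
Qed.

Lemma dpcompl_residual x y z :
  z <= x `|` y -> dpcompl y <= x `|` dpcompl z.
Proof.
move=> le_z; rewrite dpcompl_le joinA (joinC y) -(joinx_dpcompl z).
exact: leU2.
Qed.

Lemma DBS_sound (a b : formula) : a |-DBS b -> valid A a b.
Proof.
move=> ab v [vU vI vS vN v0 v1].
elim: {a b}ab =>
  [a|a b c _ ab _|a b|a b|a b c _ ab _ ac|a b|a b|a b c _ ac _ bc
  |a b c|a|a|a b|a b|||a b _ ab|a b _ ab|a b|a b|a|a|a b c _ IH|a b c _ IH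
  |a|a]; rewrite ?(vU, vI, vS, vN, v0, v1).
- exact: lexx.
- exact: le_trans.
- exact: leIl.
- exact: leIr.
- by rewrite lexI ab.
- exact: leUl.
- exact: leUr.
- by rewrite leUx ac.
- by rewrite meetUr.
- exact: lex1.
- exact: le0x.
- exact: le_pcompl_join.
- exact: dpcompl_meet_le.
- by rewrite le_pcompl meet0x.
- by rewrite dpcompl_le join1x.
- exact: le_pcompl_anti.
- exact: le_dpcompl_anti.
- exact: pcompl_dpcompl_join.
- exact: pcompl_meet_dpcompl.
- by rewrite meetx_pcompl.
- by rewrite joinx_dpcompl.
- by apply: pcompl_residual; rewrite -vI.
- by apply: dpcompl_residual; rewrite -vU.
- by rewrite pcompl_stone.
- by rewrite dpcompl_stone.
Qed.

End Soundness.

(** * Derived consequents: De Morgan laws and complemented negations *)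

Section Derivations.
Implicit Types x y z : formula.

Lemma DBS_and_mono x y x' y' :
  x |-DBS x' -> y |-DBS y' -> x \& y |-DBS x' \& y'.
Proof.
move=> xx' yy'; apply: DBS_and.
- exact: DBS_trans (DBS_andl _ _) xx'.
- exact: DBS_trans (DBS_andr _ _) yy'.
Qed.

Lemma DBS_or_mono x y x' y' :
  x |-DBS x' -> y |-DBS y' -> x \v y |-DBS x' \v y'.
Proof.
move=> xx' yy'; apply: DBS_or.
- exact: DBS_trans xx' (DBS_orl _ _).
- exact: DBS_trans yy' (DBS_orr _ _).
Qed.

Lemma DBS_sim_sim x : x |-DBS \~ \~ x.
Proof.
apply: DBS_trans (DBS_sim_res (DBS_and_sim x)).
apply: DBS_and (DBS_refl x) _.
exact: DBS_trans (DBS_top x) DBS_sim_bot.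
Qed.

Lemma DBS_neg_neg x : \neg \neg x |-DBS x.
Proof.
apply: DBS_trans (DBS_neg_res (DBS_or_neg x)) _.
apply: DBS_or (DBS_refl x) _.
exact: DBS_trans DBS_neg_top (DBS_bot x).
Qed.

(** Weakening [\~ x] to [\~ \~ \~ x] lets the mixed axiom [DBS_sim_neg_or] produce [\neg] of the
    Stone disjunction, hence [\neg Top]. *)
Lemma DBS_sim_neg_sim x : \~ x \& \neg \~ x |-DBS Bot.
Proof.
apply: DBS_trans (DBS_and_mono (DBS_sim_sim _) (DBS_refl _)) _.
apply: DBS_trans (DBS_sim_neg_or _ _) _.
apply: DBS_trans DBS_neg_top.
apply: DBS_neg_mono; apply: DBS_trans (DBS_sim_stone x) _.
by apply: DBS_or; [exact: DBS_orr|exact: DBS_orl].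
Qed.

Lemma DBS_neg_sim_neg x : Top |-DBS \neg x \v \~ \neg x.
Proof.
apply: DBS_trans DBS_sim_bot _.
apply: DBS_trans (DBS_sim_mono (DBS_neg_stone x)) _.
apply: DBS_trans (DBS_sim_neg_and _ _) _.
apply: DBS_or; first exact: DBS_orr.
exact: DBS_trans (DBS_neg_neg _) (DBS_orl _ _).
Qed.

(** Case split on the Stone disjunction for [y]: under [\~ \~ y], residuation applied twice yields
    [\~ x]. [DBS_neg_or] is the order dual. *)
Lemma DBS_sim_and x y : \~ (x \& y) |-DBS \~ x \v \~ y.
Proof.
have s_y : x \& \~ (x \& y) |-DBS \~ y by exact: DBS_sim_res (DBS_refl _).
have s_x : \~ (x \& y) \& \~ \~ y |-DBS \~ x.
  apply: DBS_sim_res; apply: DBS_trans s_y.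
  by apply: DBS_and; [exact: DBS_andr|exact: DBS_andl].
have s_s := DBS_trans (DBS_top (\~ (x \& y))) (DBS_sim_stone y).
apply: DBS_trans (DBS_and (DBS_refl _) s_s) _.
apply: DBS_trans (DBS_distr _ _ _) _.
apply: DBS_or; first exact: DBS_trans (DBS_andr _ _) (DBS_orr _ _).
exact: DBS_trans s_x (DBS_orl _ _).
Qed.

Lemma DBS_neg_or x y : \neg x \& \neg y |-DBS \neg (x \v y).
Proof.
have n_y : \neg y |-DBS x \v \neg (x \v y) by exact: DBS_neg_res (DBS_refl _).
have n_x : \neg x |-DBS \neg (x \v y) \v \neg \neg y.
  apply: DBS_neg_res; apply: DBS_trans n_y _.
  by apply: DBS_or; [exact: DBS_orr|exact: DBS_orl].
apply: DBS_trans (DBS_and (DBS_andr _ _) (DBS_trans (DBS_andl _ _) n_x)) _.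
apply: DBS_trans (DBS_distr _ _ _) _.
apply: DBS_or; first exact: DBS_andr.
exact: DBS_trans (DBS_neg_stone y) (DBS_bot _).
Qed.

End Derivations.

(** * Prime theories and their existence *)

Local Open Scope classical_set_scope.

(** These are the prime filters of the Lindenbaum algebra, pulled back to formulas so that no
    quotient is formed. *)
Record prime_theory (P : set formula) : Prop := PrimeTheory {
  prime_le : forall x y, x |-DBS y -> P x -> P y;
  prime_and : forall x y, P x -> P y -> P (x \& y);
  prime_or : forall x y, P (x \v y) -> P x \/ P y;
  prime_top : P Top;
  prime_bot : ~ P Bot
}.

Lemma prime_theory_separation (a b : formula) : ~ a |-DBS b ->
  exists P, [/\ prime_theory P, P a & ~ P b].
Proof.
move=> Nab.
(* X may be empty, so that the union of the empty chain satisfies Q. *)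
pose Q (X : set formula) :=
  [/\ forall x y, x |-DBS y -> X x -> X y,
      forall x y, X x -> X y -> X (x \& y) &
      forall x, X x -> ~ x \& a |-DBS b].
have Q_chain F : F `<=` Q -> total_on F subset -> Q (\bigcup_(X in F) X).
  move=> FQ totF; split.
  - move=> x y xy [X FX Xx]; exists X => //.
    by have [up _ _] := FQ X FX; exact: up Xx.
  - move=> x y [X FX Xx] [Y FY Yy].
    have [XY|YX] := totF X Y FX FY.
    + by exists Y => //; have [_ meet _] := FQ Y FY; apply: meet => //; exact: XY.
    + by exists X => //; have [_ meet _] := FQ X FX; apply: meet => //; exact: YX.
  - by move=> x [X FX Xx]; have [_ _ ] := FQ X FX; apply.
have [P [[P_le P_and PNb] P_max]] := Zorn_bigcup Q_chain.
have P_ext c : ~ P c ->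
    c \& a |-DBS b \/ exists2 x, P x & (x \& c) \& a |-DBS b.
  move=> NPc; apply: contrapT => /not_orP[Ncb NPcb].
  (* The filter generated by [P] and [c]; the first disjunct covers an empty [P]. *)
  pose PC : set formula := [set y | c |-DBS y \/ exists2 x, P x & x \& c |-DBS y].
  apply: (P_max PC).
    split=> [x Px|PC_P]; first by right; exists x => //; exact: DBS_andl.
    by apply: NPc; apply: PC_P; left; exact: DBS_refl.
  split.
  - move=> x y xy [cx|[z Pz zx]]; first by left; exact: DBS_trans cx xy.
    by right; exists z => //; exact: DBS_trans zx xy.
  - move=> x y [cx|[z Pz zx]] [cy|[t Pt ty]].
    + by left; exact: DBS_and.
    + right; exists t => //; apply: DBS_and ty.
      exact: DBS_trans (DBS_andr _ _) cx.
    + right; exists z => //; apply: DBS_and zx _.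
      exact: DBS_trans (DBS_andr _ _) cy.
    + right; exists (z \& t); first exact: P_and.
      apply: DBS_and.
      * exact: DBS_trans (DBS_and_mono (DBS_andl _ _) (DBS_refl _)) zx.
      * exact: DBS_trans (DBS_and_mono (DBS_andr _ _) (DBS_refl _)) ty.
  - move=> y [cy|[x Px xy]] yab.
    + by apply: Ncb; exact: DBS_trans (DBS_and_mono cy (DBS_refl _)) yab.
    + apply: NPcb; exists x => //.
      exact: DBS_trans (DBS_and_mono xy (DBS_refl _)) yab.
have Pa : P a.
  apply: contrapT => /P_ext[aab|[x Px xab]].
    by apply: Nab; apply: DBS_trans aab; apply: DBS_and; exact: DBS_refl.
  apply: (PNb _ Px); apply: DBS_trans xab.
  by apply: DBS_and (DBS_refl _) (DBS_andr _ _).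
have PNb' x : P x -> ~ x |-DBS b.
  by move=> Px xb; apply: (PNb _ Px); exact: DBS_trans (DBS_andl _ _) xb.
(* Now that [a] lies in [P], it can be absorbed into the witness, which merges the two cases of
   [P_ext]. *)
have P_ext' c : ~ P c -> exists2 x, P x & x \& c |-DBS b.
  move=> /P_ext[cab|[x Px xcab]].
    exists a => //; apply: DBS_trans cab.
    by apply: DBS_and; [exact: DBS_andr|exact: DBS_andl].
  exists (x \& a); first exact: P_and.
  apply: DBS_trans xcab; apply: DBS_and.
    exact: DBS_and_mono (DBS_andl _ _) (DBS_refl _).
  exact: DBS_trans (DBS_andl _ _) (DBS_andr _ _).
exists P; split=> //; last by move=> Pb; exact: PNb' Pb (DBS_refl b).
split=> //.
(* If both disjuncts were missing, distributivity would make [(z \& t) \& (x \v y)], a member of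
   [P], prove [b]. *)
- move=> x y Pxy; apply: contrapT => /not_orP[/P_ext'[z Pz zx] /P_ext'[t Pt ty]].
  apply: (PNb' _ (P_and _ _ (P_and _ _ Pz Pt) Pxy)).
  apply: DBS_trans (DBS_distr _ _ _) _; apply: DBS_or.
  + exact: DBS_trans (DBS_and_mono (DBS_andl _ _) (DBS_refl _)) zx.
  + exact: DBS_trans (DBS_and_mono (DBS_andr _ _) (DBS_refl _)) ty.
- exact: P_le (DBS_top a) Pa.
- by move=> P0; exact: PNb' P0 (DBS_bot b).
Qed.

(** * The valuation of a prime theory *)

Section PrimeValuation.
Context {P : set formula} (prime_P : prime_theory P).
Implicit Types x y : formula.

Lemma prime_andE x y : P (x \& y) = (P x /\ P y) :> Prop.
Proof.
apply: propext; split=> [Pxy|[Px Py]]; last exact: (prime_and prime_P).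
by split; apply: (prime_le prime_P _ Pxy); [exact: DBS_andl|exact: DBS_andr].
Qed.

Lemma prime_orE x y : P (x \v y) = (P x \/ P y) :> Prop.
Proof.
apply: propext; split=> [|[Px|Py]]; first exact: (prime_or prime_P).
- exact: (prime_le prime_P (DBS_orl x y) Px).
- exact: (prime_le prime_P (DBS_orr x y) Py).
Qed.

Lemma prime_sim_orE x y : P (\~ (x \v y)) = (P (\~ x) /\ P (\~ y)) :> Prop.
Proof.
rewrite -prime_andE; apply: propext; split; apply: (prime_le prime_P).
  apply: DBS_and; apply: DBS_sim_mono; [exact: DBS_orl|exact: DBS_orr].
exact: DBS_sim_or.
Qed.

Lemma prime_sim_andE x y : P (\~ (x \& y)) = (P (\~ x) \/ P (\~ y)) :> Prop.
Proof.
rewrite -prime_orE; apply: propext; split; apply: (prime_le prime_P).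
  exact: DBS_sim_and.
apply: DBS_or; apply: DBS_sim_mono; [exact: DBS_andl|exact: DBS_andr].
Qed.

Lemma prime_neg_orE x y : P (\neg (x \v y)) = (P (\neg x) /\ P (\neg y)) :> Prop.
Proof.
rewrite -prime_andE; apply: propext; split; apply: (prime_le prime_P).
  apply: DBS_and; apply: DBS_neg_mono; [exact: DBS_orl|exact: DBS_orr].
exact: DBS_neg_or.
Qed.

Lemma prime_neg_andE x y : P (\neg (x \& y)) = (P (\neg x) \/ P (\neg y)) :> Prop.
Proof.
rewrite -prime_orE; apply: propext; split; apply: (prime_le prime_P).
  exact: DBS_neg_and.
apply: DBS_or; apply: DBS_neg_mono; [exact: DBS_andl|exact: DBS_andr].
Qed.

Lemma prime_complE x y :
  x \& y |-DBS Bot -> Top |-DBS x \v y -> P y = ~ P x :> Prop.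
Proof.
move=> xy0 xy1; apply: propext; split=> [Py Px|NPx].
  apply: (prime_bot prime_P); apply: (prime_le prime_P xy0).
  exact: (prime_and prime_P).
have /(prime_or prime_P)[] // : P (x \v y).
  by apply: (prime_le prime_P xy1); exact: prime_top prime_P.
Qed.

Lemma prime_sim_simE x : P (\~ \~ x) = ~ P (\~ x) :> Prop.
Proof. by apply: prime_complE; [exact: DBS_and_sim|exact: DBS_sim_stone]. Qed.

Lemma prime_neg_negE x : P (\neg \neg x) = ~ P (\neg x) :> Prop.
Proof. by apply: prime_complE; [exact: DBS_neg_stone|exact: DBS_or_neg]. Qed.

Lemma prime_neg_simE x : P (\neg \~ x) = ~ P (\~ x) :> Prop.
Proof. by apply: prime_complE; [exact: DBS_sim_neg_sim|exact: DBS_or_neg]. Qed.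

Lemma prime_sim_negE x : P (\~ \neg x) = ~ P (\neg x) :> Prop.
Proof. by apply: prime_complE; [exact: DBS_and_sim|exact: DBS_neg_sim_neg]. Qed.

Lemma prime_sim_bot : P (\~ Bot).
Proof. by apply: (prime_le prime_P DBS_sim_bot _); exact: prime_top prime_P. Qed.

Lemma prime_sim_top : ~ P (\~ Top).
Proof.
apply: contra_not (prime_bot prime_P); apply: (prime_le prime_P).
exact: DBS_trans (DBS_and (DBS_top _) (DBS_refl _)) (DBS_and_sim Top).
Qed.

Lemma prime_neg_bot : P (\neg Bot).
Proof.
apply: (prime_le prime_P _ (prime_top prime_P)); apply: DBS_trans (DBS_or_neg Bot) _.
exact: DBS_or (DBS_bot _) (DBS_refl _).
Qed.

Lemma prime_neg_top : ~ P (\neg Top).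
Proof. by apply: contra_not (prime_bot prime_P); apply: (prime_le prime_P DBS_neg_top). Qed.

(** A subset of [unit] encodes a truth value. The outer coordinates are forced by the middle one:
    the middle coordinate of [\~ x] must complement the third coordinate of [x], and that of
    [\neg x] the first. *)
Definition prime_triple x : set unit *p set unit *p set unit :=
  ([set _ | ~ P (\neg x)], [set _ | P x], [set _ | ~ P (\~ x)]).

Fact prime_triple_chain x : chain3 (prime_triple x).
Proof.
apply/andP; split; apply/subsetPset => -[] /=.
- have /(prime_or prime_P)[] // : P (x \v \neg x).
  by apply: (prime_le prime_P (DBS_or_neg x) _); exact: prime_top prime_P.
- move=> Px Psx; apply: (prime_bot prime_P).
  by apply: (prime_le prime_P (DBS_and_sim x) _); exact: (prime_and prime_P).
Qed.

Definition prime_valuation x : (set unit)^[3] := Three (prime_triple_chain x).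

Lemma prime_valuationP : is_valuation prime_valuation.
Proof.
split=> [x y|x y|x|x||]; apply: val_inj.
- rewrite three_joinE /= /prime_triple prime_neg_orE prime_orE prime_sim_orE.
  by congr (_, _, _); rewrite joinEset predeqE => -[] /=; rewrite ?not_andE.
- rewrite three_meetE /= /prime_triple prime_neg_andE prime_andE prime_sim_andE.
  by congr (_, _, _); rewrite meetEset predeqE => -[] /=; rewrite ?not_orE.
(* All three coordinates of [\~ x] become equivalent to [P (\~ x)], matching the diagonal triple in
   [three_pcompl]. *)
- rewrite /= /prime_triple prime_neg_simE prime_sim_simE.
  by congr (_, _, _); rewrite complEset predeqE => -[] /=; rewrite ?notE.
- rewrite /= /prime_triple prime_neg_negE prime_sim_negE.
  by congr (_, _, _); rewrite complEset predeqE => -[] /=; rewrite ?notE.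
- rewrite three_botE /= /prime_triple.
  congr (_, _, _); rewrite botEset predeqE => -[] /=; split=> //.
  + by apply; exact: prime_neg_bot.
  + exact: prime_bot prime_P.
  + by apply; exact: prime_sim_bot.
- rewrite three_topE /= /prime_triple.
  congr (_, _, _); rewrite topEset predeqE => -[] /=; split=> // _.
  + exact: prime_neg_top.
  + exact: prime_top prime_P.
  + exact: prime_sim_top.
Qed.

End PrimeValuation.

(** * Completeness and the equivalence *)

Lemma DBS_complete (a b : formula) : valid (set unit)^[3] a b -> a |-DBS b.
Proof.
move=> Vab; apply: contrapT => /prime_theory_separation[P [prime_P Pa NPb]].
(* The middle coordinate is membership in [P], so its inequality read at [tt] carries [P a] to
   [P b]. *)
have := Vab _ (prime_valuationP prime_P); rewrite three_leE => /and3P[_ + _].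
by move=> /subsetPset/(_ tt)/(_ Pa).
Qed.

Theorem theorem15 (a b : formula) :
  [<-> a |-DBS b;
       forall (d : Order.disp_t) (A : doubleStoneType d), valid A a b;
       forall (d : Order.disp_t) (B : ctbDistrLatticeType d), valid B^[3] a b;
       forall U : Type, valid (set U)^[3] a b].
Proof.
tfae.
- by move=> ab d A; exact: DBS_sound.
- by move=> Vab d B; exact: Vab.
- by move=> Vab U; exact: Vab.
- by move=> Vab; apply: DBS_complete; exact: Vab.
Qed.
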